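(* Let $m,n$ be integers with $1\le m<n$ and $n\le 2m+1$. Then $\dim(VG^2_{m,n})=3$.
   Context: For a connected graph $G$ and an ordered set $R=\{r_1,\dots,r_l\}\subseteq V(G)$, the code of a vertex $s$ is $(d(s,r_1),\dots,d(s,r_l))$, where $d$ is the shortest-path distance. $R$ is a resolving set if distinct vertices have distinct codes; $\dim(G)$ (the metric dimension) is the minimum cardinality of a resolving set. For integers $1\le m<n$, the Villarceau grid Type II $VG^2_{m,n}$ is the graph with vertex set $\{(2i+1,2j+1): i\in\{0,\dots,n-2\},\ j\in\{0,\dots,m-1\}\}\cup\{(2i,2j): i\in\{0,\dots,n-1\},\ j\in\{0,\dots,m\}\}$, in which $(i_1,j_1)$ and $(i_2,j_2)$ are adjacent if and only if $|i_1-i_2|=1$ and $|j_1-j_2|=1$. *)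

(* Defs.v *)
From mathcomp Require Import all_boot ssrint.

Set Implicit Arguments.
Unset Strict Implicit.
Unset Printing Implicit Defensive.

Section MetricDimension.

Variables (T : finType) (e : rel T).

Definition has_walk (x y : T) (k : nat) : bool :=
  [exists p : k.-tuple T, path e x p && (last x p == y)].

(* Any vertex reachable from x is reached by a walk with fewer than #|T| edges
   (see dist_walk, dist_min), so searching k < #|T| suffices; the junk value
   for unreachable vertices is #|T|. *)
Definition dist (x y : T) : nat := find (has_walk x y) (iota 0 #|T|).

Definition code (R : seq T) (s : T) : seq nat := [seq dist s r | r <- R].

Definition resolving (R : seq T) : bool := injectiveb (code R).

(* The order in which R is listed does not affect whether it is resolving, so
   the minimum is taken over unordered sets, listed by enum.  The default
   candidate [set: T] is resolving (resolving_setT). *)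
Definition metric_dim : nat :=
  #|[arg min_(R < [set: T] | resolving (enum R)) #|R| ]|.

Lemma has_walkP x y k :
  reflect (exists p : seq T, [/\ path e x p, last x p = y & size p = k])
          (has_walk x y k).
Proof.
apply: (iffP existsP) => [[p /andP[ep /eqP lp]]|[p [ep lp sp]]].
  by exists p; rewrite size_tuple.
by exists (Tuple (introT eqP sp)); rewrite /= ep lp eqxx.
Qed.

Lemma dist_min x p : path e x p -> dist x (last x p) <= size p.
Proof.
move=> ep; have [ltp|lep] := ltnP (size p) #|T|.
  rewrite leqNgt; apply/negP => /(before_find 0).
  rewrite nth_iota // add0n => hw.
  by have /has_walkP : exists q, [/\ path e x q, last x q = last x p
    & size q = size p]; [exists p | rewrite hw].
by apply: leq_trans (find_size _ _) _; rewrite size_iota.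
Qed.

Lemma dist_walk x y : connect e x y ->
  exists p : seq T, [/\ path e x p, last x p = y & size p = dist x y].
Proof.
case/connectP=> p0 /shortenP[p ep up _] ->.
apply/has_walkP; have ltp : size p < #|T|.
  by have := max_card [in x :: p]; rewrite (card_uniqP up).
have hw : has (has_walk x (last x p)) (iota 0 #|T|).
  apply/hasP; exists (size p); first by rewrite mem_iota.
  by apply/has_walkP; exists p.
have := nth_find 0 hw; rewrite nth_iota ?add0n //.
by rewrite -[X in _ < X](size_iota 0) -has_find.
Qed.

Lemma dist0P x y : reflect (x = y) (dist x y == 0).
Proof.
apply: (iffP eqP) => [d0|<-]; last first.
  by apply/eqP; rewrite -leqn0; apply: (@dist_min x [::]).
have hw : has (has_walk x y) (iota 0 #|T|).
  by rewrite has_find -/(dist x y) d0 size_iota; apply/card_gt0P; exists x.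
have := nth_find 0 hw; rewrite -/(dist x y) d0 nth_iota ?add0n.
  by case/has_walkP=> p [_ <- /size0nil ->].
by apply/card_gt0P; exists x.
Qed.

Lemma resolving_setT : resolving (enum [set: T]).
Proof.
apply/injectiveP => x y /eq_in_map/(_ x).
rewrite mem_enum inE => /(_ isT) dxy.
by apply/esym/dist0P; rewrite -dxy; apply/dist0P.
Qed.

End MetricDimension.

Definition vg2_vertices (m n : nat) : seq (nat * nat) :=
  [seq (2 * i + 1, 2 * j + 1) | i <- iota 0 (n - 1), j <- iota 0 m] ++
  [seq (2 * i, 2 * j) | i <- iota 0 n, j <- iota 0 m.+1].

Definition vg2 (m n : nat) : finType := seq_sub (vg2_vertices m n).

(* The differences are taken in int, not truncated. *)
Definition vg2_adj (m n : nat) : rel (vg2 m n) := fun u v =>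
  let: (i1, j1) := ssval u in
  let: (i2, j2) := ssval v in
  (`|i1 - i2| == 1)%N && (`|j1 - j2| == 1)%N.

Arguments vg2_adj : clear implicits.

(* Main.v *)
Require Import Defs.
From mathcomp Require Import all_boot ssrint.
From mathcomp Require Import zify.

(** The vertices of the grid are the points of [0, 2n-2] x [0, 2m] whose two
    coordinates have the same parity, and its graph distance is the Chebyshev
    distance.  The three points (0, 0), (2n-2, 0) and (2(n-1-m), 2m) resolve
    the grid: the first two leave undetermined only y in the triangle
    y <= min (x, 2n-2-x) and x in the triangle y > max (x, 2n-2-x), and the
    third one recovers both coordinates there.  No two points p, q suffice:
    p is equal or adjacent to a vertex s of degree 4, at least three
    neighbours of s are equidistant from p, and, the graph being bipartite,
    their distances to q take only the two values d(q, s) - 1 and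
    d(q, s) + 1. *)

(** * Resolving sets and sets of at most two elements *)

Lemma resolvingP (T : finType) (e : rel T) (A : {set T}) :
  reflect (forall s t, {in A, dist e s =1 dist e t} -> s = t)
          (resolving e (enum A)).
Proof.
apply: (iffP (@injectiveP T _ (code e (enum A)))) => inj s t st.
  by apply: inj; apply/eq_in_map => r; rewrite mem_enum => /st.
by apply: inj => r rA; move/eq_in_map: st; apply; rewrite mem_enum.
Qed.

(** The default [x0] pads the pair when [A] has fewer than two elements, so that a single pair
    covers all cases. *)
Lemma cards_le2_sub (T : finType) (x0 : T) (A : {set T}) :
  #|A| <= 2 -> exists p q, A \subset [set p; q].
Proof.
move=> A2; exists (nth x0 (enum A) 0), (nth x0 (enum A) 1).
apply/subsetP => r rA; rewrite !inE.
have rE : r \in enum A by rewrite mem_enum.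
rewrite -(nth_index x0 rE).
have : index r (enum A) < 2.
  by apply: leq_trans A2; rewrite cardE index_mem.
by case: (index r _) => [|[|]] //; rewrite eqxx ?orbT.
Qed.

(** * The graph distance is the Chebyshev distance *)

(** At least one of the truncated differences vanishes, so this is |a - b|, kept in [nat] for
    [lia]. *)
Definition gap (a b : nat) : nat := (a - b) + (b - a).

Lemma gap_eq0 a b : (gap a b == 0) = (a == b).
Proof. by rewrite /gap; lia. Qed.

Lemma odd_gap a b : odd (gap a b) = odd a (+) odd b.
Proof.
rewrite /gap; have [ab|/ltnW ab] := leqP a b.
  by rewrite (eqnP ab) oddB // addbC.
by rewrite (eqnP ab) addn0 oddB.
Qed.

Definition chebyshev (u v : nat * nat) : nat :=
  maxn (gap u.1 v.1) (gap u.2 v.2).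

Definition in_grid (m n : nat) (u : nat * nat) : bool :=
  [&& u.1 <= 2 * (n - 1), u.2 <= 2 * m & odd u.1 == odd u.2].

Lemma mem_vg2_vertices m n u : 0 < n ->
  (u \in vg2_vertices m n) = in_grid m n u.
Proof.
case: u => x y n0; rewrite /in_grid mem_cat; apply/orP/idP.
  by case=> /allpairsPdep[i [j]]; rewrite !mem_iota => -[ilt jlt [-> ->]] /=; lia.
case/and3P => xle yle /eqP oxy.
rewrite /= in xle yle oxy.
case ox: (odd x); [left | right].
  by apply/allpairsPdep; exists x./2, y./2; rewrite !mem_iota;
    split; [lia | lia | congr pair; lia].
by apply/allpairsPdep; exists x./2, y./2; rewrite !mem_iota;
  split; [lia | lia | congr pair; lia].
Qed.

Lemma vg2_in_grid m n (s : vg2 m n) : 0 < n -> in_grid m n (ssval s).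
Proof. by move=> n0; rewrite -mem_vg2_vertices //; apply: ssvalP. Qed.

Lemma in_grid_vg2 m n u : 0 < n -> in_grid m n u ->
  exists s : vg2 m n, ssval s = u.
Proof. by move=> n0; rewrite -mem_vg2_vertices // => us; exists (SeqSub us). Qed.

Lemma vg2_adjE m n (s t : vg2 m n) : vg2_adj m n s t =
  (gap (ssval s).1 (ssval t).1 == 1) && (gap (ssval s).2 (ssval t).2 == 1).
Proof.
rewrite /vg2_adj /gap; case: (ssval s) (ssval t) => [x y] [x' y'] /=; lia.
Qed.

Lemma chebyshev_path m n (s : vg2 m n) p : path (vg2_adj m n) s p ->
  chebyshev (ssval s) (ssval (last s p)) <= size p.
Proof.
elim: p s => [|t p IH] s /=; first by rewrite /chebyshev /gap; lia.
rewrite vg2_adjE => /andP[st /IH]; move: st; rewrite /chebyshev /gap.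
by case: (ssval s) (ssval t) (ssval (last t p)) => [a b] [c d] [f g] /=; lia.
Qed.

(** Both coordinates change along every edge, so a coordinate that has already reached its target
    must leave it, which makes its gap 1. *)
Lemma line_step top a c : 1 < top -> a <= top -> c <= top ->
  exists w, [/\ w <= top, gap a w = 1 &
    gap w c = if gap a c == 0 then 1 else (gap a c).-1].
Proof.
rewrite gap_eq0 /gap => top1 atop ctop.
case: (ltngtP a c) => ac; [exists a.+1 | exists a.-1 |].
- by split; lia.
- by split; lia.
- by case: (ltnP a top) => lt_a; [exists a.+1 | exists a.-1]; split; lia.
Qed.

Lemma gap1_odd a b : gap a b = 1 -> odd b = ~~ odd a.
Proof.
by move=> ab1; have := odd_gap a b; rewrite ab1; case: (odd a) (odd b) => [] [].
Qed.

(** If exactly one gap is 0, equal parity makes the other at least 2, so the forced move from 0 to 1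
    does not exceed the predecessor of the other. *)
Lemma maxn_pred x y : odd x = odd y -> (x != 0) || (y != 0) ->
  (maxn (if x == 0 then 1 else x.-1) (if y == 0 then 1 else y.-1)).+1 = maxn x y.
Proof. by case: (x =P 0) => [->|]; case: (y =P 0) => [->|] //=; lia. Qed.

Lemma grid_step m n u v : 0 < m -> 1 < n -> in_grid m n u -> in_grid m n v ->
  u != v -> exists w, [/\ in_grid m n w, gap u.1 w.1 = 1, gap u.2 w.2 = 1 &
    (chebyshev w v).+1 = chebyshev u v].
Proof.
move=> m0 n1; case: u v => [a b] [c d].
rewrite /in_grid /chebyshev /= => /and3P[an bm /eqP ab] /and3P[cn dm /eqP cd].
rewrite xpair_eqE negb_and -(gap_eq0 a c) -(gap_eq0 b d) => uv.
have n2 : 1 < 2 * (n - 1) by lia.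
have m2 : 1 < 2 * m by lia.
have [x [xn ax xc]] := line_step _ _ _ n2 an cn.
have [y [ym by1 yd]] := line_step _ _ _ m2 bm dm.
exists (x, y); split=> //=.
  by rewrite xn ym (gap1_odd _ _ ax) (gap1_odd _ _ by1) ab eqxx.
have : odd (gap a c) = odd (gap b d) by rewrite !odd_gap ab cd.
by rewrite xc yd => /maxn_pred->.
Qed.

Lemma vg2_walk m n k (s t : vg2 m n) : 0 < m -> 1 < n ->
  chebyshev (ssval s) (ssval t) = k ->
  exists p, [/\ path (vg2_adj m n) s p, last s p = t & size p = k].
Proof.
move=> m0 n1; elim: k s => [|k IH] s st.
  exists [::]; split=> //; apply: val_inj; move: st => /=.
  by rewrite /chebyshev /gap; case: (ssval s) (ssval t) => a b [c d] /= st;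
    congr pair; lia.
have n0 : 0 < n by lia.
have neq : ssval s != ssval t.
  by apply/eqP => st'; move: st; rewrite st' /chebyshev /gap; lia.
have [w [wg sw1 sw2 wt]] :=
  grid_step _ _ _ _ m0 n1 (vg2_in_grid _ _ s n0) (vg2_in_grid _ _ t n0) neq.
have [r rw] := in_grid_vg2 _ _ _ n0 wg.
have [|p [rp lp sp]] := IH r; first by rewrite rw; lia.
by exists (r :: p); rewrite /= rp lp sp vg2_adjE rw sw1 sw2.
Qed.

Lemma dist_vg2 m n (s t : vg2 m n) : 0 < m -> 1 < n ->
  dist (vg2_adj m n) s t = chebyshev (ssval s) (ssval t).
Proof.
move=> m0 n1; have [p [sp lp szp]] := vg2_walk _ _ _ s t m0 n1 erefl.
apply/eqP; rewrite eqn_leq -szp -{1}lp dist_min //= szp.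
have [|q [sq lq <-]] := @dist_walk _ (vg2_adj m n) s t.
  by apply/connectP; exists p.
by rewrite -{1}lq chebyshev_path.
Qed.

(** * Three landmarks suffice *)

(** Here t = 2(n-1), s = 2m, k = 2(n-1-m), and primes denote complements. If b <= min (a, a'), then
    a - k <= b' because a + b <= t, and k - a <= b' because k <= s, so the third distance is b'. If
    b > max (a, a'), then a + b > t gives a - k > b', so the third distance is a - k. *)
Lemma three_landmarks_arith t s k a a' b b' c c' d d' :
  a + a' = t -> c + c' = t -> b + b' = s -> d + d' = s -> s + k = t -> k <= s ->
  maxn a b = maxn c d -> maxn a' b = maxn c' d ->
  maxn (gap a k) b' = maxn (gap c k) d' -> a = c /\ b = d.
Proof.
move=> at_ ct bs ds kt ks.
case: (leqP a b) => ab; case: (leqP c d) => cd; case: (leqP a' b) => ab';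
  case: (leqP c' d) => cd' e1 e2; rewrite /gap;
  by case: (leqP a k) => [ak|ak]; case: (leqP c k) => [ck|ck]; lia.
Qed.

Lemma gap_le a b : a <= b -> gap a b = b - a.
Proof. by rewrite /gap => /eqnP->. Qed.

Lemma gapn0 a : gap a 0 = a.
Proof. by rewrite /gap subn0 sub0n addn0. Qed.

Lemma three_landmarks m n u v : m < n -> n <= 2 * m + 1 ->
  in_grid m n u -> in_grid m n v ->
  {in [:: (0, 0); (2 * (n - 1), 0); (2 * (n - 1 - m), 2 * m)],
    chebyshev u =1 chebyshev v} -> u = v.
Proof.
move=> mn nm.
have kt : 2 * m + 2 * (n - 1 - m) = 2 * (n - 1) by lia.
have ks : 2 * (n - 1 - m) <= 2 * m by lia.
case: u v => [a b] [c d] /and3P[/= an bm _] /and3P[/= cn dm _] uv.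
have := uv (0, 0); have := uv (2 * (n - 1), 0).
have := uv (2 * (n - 1 - m), 2 * m).
rewrite !inE !eqxx !orbT /chebyshev /= => /(_ isT) e3 /(_ isT) e2 /(_ isT) e1.
move: e1 e2 e3; rewrite !gapn0.
rewrite !(gap_le _ _ an, gap_le _ _ bm, gap_le _ _ cn, gap_le _ _ dm).
move=> e1 e2 e3.
by have [-> ->] := three_landmarks_arith _ _ _ _ _ _ _ _ _ _ _ (subnKC an)
  (subnKC cn) (subnKC bm) (subnKC dm) kt ks e1 e2 e3.
Qed.

(** * Two landmarks never suffice *)

Definition degree4 (m n : nat) (u : nat * nat) : bool :=
  [&& 0 < u.1, u.1 < 2 * (n - 1), 0 < u.2 & u.2 < 2 * m].

Lemma near_degree4 m n p : 0 < m -> 1 < n -> in_grid m n p ->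
  exists s, [/\ in_grid m n s, degree4 m n s & chebyshev p s <= 1].
Proof.
move=> m0 n1; case: p => a b; rewrite /in_grid /degree4 /chebyshev /gap /= => pg.
case pd: [&& 0 < a, a < 2 * (n - 1), 0 < b & b < 2 * m].
  by exists (a, b) => /=; split; lia.
(* A boundary point has an extreme, hence even, coordinate, so both are even: a nonzero one is at
   least 2, and its predecessor is strictly inside. *)
exists (if a == 0 then 1 else a.-1, if b == 0 then 1 else b.-1) => /=.
by split; case: (a =P 0); case: (b =P 0); lia.
Qed.

Lemma pigeonhole3 (T : Type) (f : T -> nat) (k l : nat) (x y z : T) :
  f x = k \/ f x = l -> f y = k \/ f y = l -> f z = k \/ f z = l ->
  [\/ f x = f y, f x = f z | f y = f z].
Proof.
by case=> -> [] -> [] ->; [constructor 1|constructor 1|constructor 2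
  |constructor 3|constructor 3|constructor 2|constructor 1|constructor 1].
Qed.

Lemma gap_step a b c : gap a b = 1 ->
  gap b c = (gap a c).+1 \/ (gap b c).+1 = gap a c.
Proof. by rewrite /gap; lia. Qed.

(** Distinct numbers of equal parity differ by at least 2, so under unit changes the smaller can
    catch up with the larger but not overtake it. *)
Lemma maxn_step x y x' y' : odd x = odd y ->
  x' = x.+1 \/ x'.+1 = x -> y' = y.+1 \/ y'.+1 = y ->
  maxn x' y' = (maxn x y).+1 \/ maxn x' y' = (maxn x y).-1.
Proof.
by move=> + x1 y1; case: x1 => [->|<-]; case: y1 => [->|<-] /=; lia.
Qed.

Lemma chebyshev_bipartite m n u w q : in_grid m n u -> in_grid m n q ->
  gap u.1 w.1 = 1 -> gap u.2 w.2 = 1 ->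
  chebyshev w q = (chebyshev u q).+1 \/ chebyshev w q = (chebyshev u q).-1.
Proof.
case/and3P=> _ _ /eqP uo /and3P[_ _ /eqP qo] uw1 uw2.
have ouq : odd (gap u.1 q.1) = odd (gap u.2 q.2) by rewrite !odd_gap uo qo.
exact: maxn_step ouq (gap_step _ _ _ uw1) (gap_step _ _ _ uw2).
Qed.

(** If p = s, all neighbours of s are at distance 1 from p. If p is itself a neighbour of s, the
    other three are at distance 2 from p. *)
Lemma equidistant_neighbours m n p s :
  in_grid m n p -> in_grid m n s -> degree4 m n s -> chebyshev p s <= 1 ->
  exists x y z, [/\ uniq [:: x; y; z], chebyshev x p = chebyshev y p,
    chebyshev y p = chebyshev z p &
    forall w, w \in [:: x; y; z] ->
      [/\ in_grid m n w, gap s.1 w.1 = 1 & gap s.2 w.2 = 1]].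
Proof.
(* Writing s as (c+1, d+1) turns its neighbours into the corners with coordinates c or c+2 and d or
   d+2. *)
case: p s => [a b] [[|c] [|d]]; rewrite /in_grid /degree4 /= ?andbF //.
move=> /and3P[_ _ /eqP oab] /and3P[_ _ /eqP ocd] /andP[cn dm].
rewrite /chebyshev geq_max /= => /andP[ac bd].
have corner x y : x \in [:: c; c.+2] -> y \in [:: d; d.+2] ->
    [/\ [&& x <= 2 * (n - 1), y <= 2 * m & odd x == odd y],
      gap c.+1 x = 1 & gap d.+1 y = 1].
  by rewrite !inE => /pred2P[]-> /pred2P[]->; rewrite /= in ocd *; split;
    rewrite /gap; lia.
have gapSSn k : gap k.+2 k = 2 by rewrite /gap; lia.
have gapnSS k : gap k k.+2 = 2 by rewrite /gap; lia.
have gapSnn k : gap k.+1 k = 1 by rewrite /gap; lia.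
have gapnSn k : gap k k.+1 = 1 by rewrite /gap; lia.
have gapnn k : gap k k = 0 by rewrite /gap; lia.
have corners x y z : {subset [:: x; y; z] <=
      [:: (c, d); (c, d.+2); (c.+2, d); (c.+2, d.+2)]} ->
    forall w, w \in [:: x; y; z] ->
    [/\ [&& w.1 <= 2 * (n - 1), w.2 <= 2 * m & odd w.1 == odd w.2],
      gap c.+1 w.1 = 1 & gap d.+1 w.2 = 1].
  move=> sub w /sub; rewrite !inE => /or4P[] /eqP-> /=; apply: corner;
    by rewrite !inE eqxx ?orbT.
have acases : [\/ a = c, a = c.+1 | a = c.+2].
  case: (ltngtP a c.+1) => h; [constructor 1|constructor 3|constructor 2] => //;
    by move: ac; rewrite /gap; lia.
have bcases : [\/ b = d, b = d.+1 | b = d.+2].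
  case: (ltngtP b d.+1) => h; [constructor 1|constructor 3|constructor 2] => //;
    by move: bd; rewrite /gap; lia.
(* Parity excludes the four positions of p beside s along an axis; the centre and the four corners
   remain. *)
case: acases bcases oab => [->|->|->] [->|->|->] oab; rewrite /= in oab ocd;
  try by move: oab ocd; case: (odd c); case: (odd d).
(* When p is a corner, the triple omits p; in the third case p is the centre and any triple of
   corners works. *)
1: exists (c, d.+2), (c.+2, d), (c.+2, d.+2).
2: exists (c, d), (c.+2, d), (c.+2, d.+2).
3: exists (c, d), (c, d.+2), (c.+2, d).
4: exists (c, d), (c, d.+2), (c.+2, d.+2).
5: exists (c, d), (c, d.+2), (c.+2, d).
all: split; last by apply: corners => w; rewrite !inE => /or3P[] ->;
  rewrite ?orbT.
all: rewrite /= ?inE ?xpair_eqE ?(gapSSn, gapnSS, gapSnn, gapnSn, gapnn) //; lia.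
Qed.

Lemma two_landmarks_fail m n p q : 0 < m -> 1 < n ->
  in_grid m n p -> in_grid m n q ->
  exists u v, [/\ in_grid m n u, in_grid m n v, u != v,
    chebyshev u p = chebyshev v p & chebyshev u q = chebyshev v q].
Proof.
move=> m0 n1 pg qg; have [s [sg sd ps]] := near_degree4 _ _ _ m0 n1 pg.
have [x [y [z [uxyz xy yz near]]]] :=
  equidistant_neighbours _ _ _ _ pg sg sd ps.
have dq w : w \in [:: x; y; z] -> chebyshev w q = (chebyshev s q).+1 \/
    chebyshev w q = (chebyshev s q).-1.
  by case/near => _; apply: (chebyshev_bipartite m n).
have xin : x \in [:: x; y; z] by rewrite !inE eqxx.
have yin : y \in [:: x; y; z] by rewrite !inE eqxx orbT.
have zin : z \in [:: x; y; z] by rewrite !inE eqxx !orbT.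
have [[xg _ _] [yg _ _] [zg _ _]] := And3 (near _ xin) (near _ yin) (near _ zin).
move: uxyz; rewrite /= !inE negb_or andbT => /andP[/andP[nxy nxz] nyz].
have [e|e|e] := pigeonhole3 _ (chebyshev^~ q) _ _ _ _ _
  (dq _ xin) (dq _ yin) (dq _ zin).
- by exists x, y.
- by exists x, z; split=> //; rewrite xy.
- by exists y, z.
Qed.

Theorem theorem3 (m n : nat) (hm : 1 <= m) (hmn : m < n) (hn : n <= 2 * m + 1) :
  metric_dim (vg2_adj m n) = 3.
Proof.
have n1 : 1 < n by lia.
have n0 : 0 < n by lia.
have grid := @in_grid_vg2 m n _ n0.
have [a av] : exists a : vg2 m n, ssval a = (0, 0).
  by apply: grid; rewrite /in_grid /=; lia.
have [b bv] : exists b : vg2 m n, ssval b = (2 * (n - 1), 0).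
  by apply: grid; rewrite /in_grid /=; lia.
have [c cv] : exists c : vg2 m n, ssval c = (2 * (n - 1 - m), 2 * m).
  by apply: grid; rewrite /in_grid /=; lia.
have abc : resolving (vg2_adj m n) (enum [set a; b; c]).
  apply/resolvingP => s t st; apply: val_inj.
  apply: (three_landmarks m n) => //; try exact: vg2_in_grid.
  have st' r : r \in [set a; b; c] ->
      chebyshev (ssval s) (ssval r) = chebyshev (ssval t) (ssval r).
    by move/st; rewrite !(dist_vg2 _ _ _ _ hm n1).
  move=> r; rewrite !inE => /or3P[] /eqP->; rewrite -?av -?bv -?cv;
    by apply: st'; rewrite !inE eqxx ?orbT.
rewrite /metric_dim; case: arg_minnP => [|A Ares Amin].
  exact: resolving_setT.
apply/eqP; rewrite eqn_leq; apply/andP; split.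
  (* Minimality of [A] against the three landmarks gives the upper bound. *)
  apply: leq_trans (Amin _ abc) _.
  by rewrite -setUA cardsU1 cards2; case: (_ \notin _); case: (_ != _).
rewrite ltnNge; apply/negP => A2.
(* Two vertices that agree on p and q agree on all of [A], contradicting that [A] resolves. *)
have [p [q /subsetP Apq]] := cards_le2_sub _ a _ A2.
have [u [v [ug vg uv eqp eqq]]] := two_landmarks_fail _ _ _ _ hm n1
  (vg2_in_grid _ _ p n0) (vg2_in_grid _ _ q n0).
have [s su] := grid _ ug; have [t tv] := grid _ vg.
case/eqP: uv; rewrite -su -tv; congr ssval.
move/resolvingP: Ares; apply => r /Apq; rewrite !dist_vg2 // su tv !inE.
by case/orP => /eqP->.
Qed.
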